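(* Let $\mathcal{I}$ be any one of $\mathcal{P}$, $\mathcal{P}_\infty$, $\mathcal{B}$. The isometry classes $\{\mu\in\mathcal{I}: X_\mu$ is LOH$\}$ and $\{\mu\in\mathcal{I}: X_\mu$ is OH$\}$ are $G_\delta$-complete in $\mathcal{I}$.
   Context: Coding: $V$ is the set of finitely supported rational sequences; $\mathcal{P}\subset\mathbb{R}^V$ the seminorms on $V$ with pointwise convergence topology; for $\mu\in\mathcal{P}$, $\bar\mu$ is its seminorm extension to $c_{00}$ and $X_\mu$ the completion of $c_{00}/\{\bar\mu=0\}$; $\mathcal{P}_\infty=\{\mu:\dim X_\mu=\infty\}$, $\mathcal{B}=\{\mu\in\mathcal{P}_\infty:\bar\mu$ a norm on $c_{00}\}$, subspace topologies. LOH: for every $\varepsilon>0$ and $x\in X$ there is $y\in S_X$ with $\|tx+y\|\ge(1-\varepsilon)(|t|\|x\|+\|y\|)$ for all $t\in\mathbb{R}$. OH: for every finite-dimensional subspace $E\subset X$ and $\varepsilon>0$ there is $y\in S_X$ with $\|x+y\|\ge(1-\varepsilon)(\|x\|+\|y\|)$ for all $x\in E$. A set $A$ in a Polish space $Z$ is $G_\delta$-complete if it is $G_\delta$ and every $G_\delta$ subset of every zero-dimensional Polish space is a continuous preimage of $A$. *)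

(* Defs.v *)
From HB Require Import structures.
From mathcomp Require Import all_boot all_order all_algebra.
From mathcomp Require Import all_classical all_reals all_analysis.
From mathcomp Require Import borel_hierarchy.
Set Implicit Arguments. Unset Strict Implicit. Unset Printing Implicit Defensive.
Import Order.TTheory GRing.Theory Num.Theory.
Import numFieldNormedType.Exports.
Local Open Scope classical_set_scope.
Local Open Scope ring_scope.

Definition finsupp (T : zmodType) (x : nat -> T) : Prop :=
  exists N : nat, forall n : nat, (N <= n)%N -> x n = 0.

Definition V := {v : nat -> rat | finsupp v}.

Definition RV (R : realType) := {ptws V -> R}.

Definition seminormV (R : realType) (mu : V -> R) : Prop :=
  (forall v : V, 0 <= mu v) /\
  (forall v w u : V, (forall i, sval u i = sval v i + sval w i) ->
       mu u <= mu v + mu w) /\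
  (forall (q : rat) (v u : V), (forall i, sval u i = q * sval v i) ->
       mu u = ratr `|q| * mu v).

Definition Pset (R : realType) : set (RV R) := [set mu | seminormV mu].
Arguments Pset R : clear implicits.

Definition muext (R : realType) (mu : V -> R) (w : nat -> rat) : R :=
  match pselect (finsupp w) with
  | left h => mu (exist _ w h)
  | right _ => 0
  end.

(* rational approximations (mesh 1/(k+1)) of a real sequence; they
   preserve the support *)
Definition approx (R : realType) (k : nat) (x : nat -> R) : nat -> rat :=
  fun i => ((Num.floor (k.+1%:R * x i))%:~R / k.+1%:R)%R.

(* mubar = the (unique, continuous) seminorm extension of mu to c00 *)
Definition mubar (R : realType) (mu : V -> R) (x : nat -> R) : R :=
  limn (fun k => muext mu (approx k x)).

(* The completion X_mu of c00 / {mubar = 0}: its points are represented by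
   mubar-Cauchy sequences in c00 (two of them being identified when the
   norm of their difference is 0); linear operations are pointwise. *)
Definition Xmu (R : realType) (mu : V -> R) : set (nat -> nat -> R) :=
  [set s | (forall n, finsupp (s n)) /\
     forall e : R, 0 < e -> exists N : nat, forall m n : nat,
       (N <= m)%N -> (N <= n)%N -> mubar mu (fun i => s m i - s n i) < e].

Definition Xnorm (R : realType) (mu : V -> R) (s : nat -> nat -> R) : R :=
  limn (fun n => mubar mu (s n)).

Definition Xlin (R : realType) (t : R) (x y : nat -> nat -> R) :=
  fun k j => t * x k j + y k j.

Definition Xcomb (R : realType) (n : nat) (a : 'I_n -> R)
  (f : 'I_n -> nat -> nat -> R) : nat -> nat -> R :=
  fun k j => \sum_(i < n) a i * f i k j.

Definition Xinfdim (R : realType) (mu : V -> R) : Prop :=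
  forall n : nat, exists f : 'I_n -> nat -> nat -> R,
    (forall i, Xmu mu (f i)) /\
    forall a : 'I_n -> R, Xnorm mu (Xcomb a f) = 0 -> forall i, a i = 0.

Definition Pinf (R : realType) : set (RV R) :=
  [set mu | Pset R mu /\ Xinfdim mu].
Arguments Pinf R : clear implicits.

Definition Bset (R : realType) : set (RV R) :=
  [set mu | Pinf R mu /\
     forall x : nat -> R, finsupp x -> mubar mu x = 0 -> x = (fun _ => 0)].
Arguments Bset R : clear implicits.

Definition LOH (R : realType) (mu : V -> R) : Prop :=
  forall e : R, 0 < e -> forall x, Xmu mu x ->
    exists y, Xmu mu y /\ Xnorm mu y = 1 /\
      forall t : R,
        (1 - e) * (`|t| * Xnorm mu x + Xnorm mu y) <= Xnorm mu (Xlin t x y).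

(* OH for X_mu: finite-dimensional subspaces E are the spans of finite
   families f_0, ..., f_{n-1} of points of X_mu *)
Definition OH (R : realType) (mu : V -> R) : Prop :=
  forall (n : nat) (f : 'I_n -> nat -> nat -> R), (forall i, Xmu mu (f i)) ->
  forall e : R, 0 < e ->
    exists y, Xmu mu y /\ Xnorm mu y = 1 /\
      forall a : 'I_n -> R,
        (1 - e) * (Xnorm mu (Xcomb a f) + Xnorm mu y)
          <= Xnorm mu (Xlin 1 (Xcomb a f) y).

Definition polish (R : realType) (Z : topologicalType) : Prop :=
  (exists d : Z -> Z -> R,
     (forall x y, 0 <= d x y) /\ (forall x y, d x y = 0 <-> x = y) /\
     (forall x y, d x y = d y x) /\
     (forall x y z, d x z <= d x y + d y z) /\
     (forall (x : Z) (A : set Z),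
        nbhs x A <-> exists2 e : R, 0 < e & [set y | d x y < e] `<=` A) /\
     (forall u : nat -> Z,
        (forall e : R, 0 < e -> exists N : nat, forall m n : nat,
           (N <= m)%N -> (N <= n)%N -> d (u m) (u n) < e) ->
        exists l : Z, forall e : R, 0 < e ->
          exists N : nat, forall n : nat, (N <= n)%N -> d (u n) l < e)) /\
  (exists D : set Z, countable D /\ closure D = [set: Z]).

Definition zero_dim (Z : topologicalType) : Prop :=
  forall (x : Z) (A : set Z), nbhs x A ->
    exists U : set Z, clopen U /\ U x /\ U `<=` A.

Definition Gdelta_complete (R : realType) (I A : set (RV R)) : Prop :=
  A `<=` I /\
  (exists G : nat -> set (RV R), (forall i, open (G i)) /\
      A = I `&` \bigcap_i G i) /\
  (forall Z : topologicalType, polish R Z -> zero_dim Z ->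
     forall B : set Z, Gdelta B ->
       exists f : Z -> RV R,
         continuous f /\ (forall z, I (f z)) /\ B = f @^-1` A).

(* Main.v *)
Require Import Defs.
From HB Require Import structures.
From mathcomp Require Import all_boot all_order all_algebra.
From mathcomp Require Import all_classical all_reals all_analysis.
From mathcomp Require Import borel_hierarchy ring lra.
Set Implicit Arguments. Unset Strict Implicit. Unset Printing Implicit Defensive.
Import Order.TTheory GRing.Theory Num.Theory.
Import numFieldNormedType.Exports.
Local Open Scope classical_set_scope.
Local Open Scope ring_scope.

(** Upper bound: in the definition of OH, vectors [x] of large norm satisfy the
    inequality trivially, and a bounded part of a finite-dimensional subspace is
    totally bounded; so OH says that for finitely many rational vectors
    [u_1, ..., u_r] in [V] and [k] there is [w] in [V] with
    [|mu w - 1| < 1/(k+1)] and [mu (u_j + w) > mu u_j + mu w - 1/(k+1)] for all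
    [j], an open condition on [mu]. LOH is the same with all [u_j] multiples of
    one vector.

    Hardness: given weights [a_n] in [[0, 1]], put [N_0 = 0] and
    [N_(n+1) = max (N_n, |x_n|, a_n (N_n + |x_n|))]. If [a_n = 1] for
    infinitely many [n], the space is OH, with the basis vectors [e_n] as
    witnesses; if [a_n = 0] for all [n >= m], then [e_m] refutes LOH. For
    [B] the intersection of the open sets [F_i], let [g_i] be the distance to
    the complement of [F_0 cap ... cap F_i], truncated at [1/(i+1)]. Bump
    functions of [n g_i(z)], [i < n], give weights continuous in [z] that equal
    1 infinitely often if [z] is in [B] and vanish eventually otherwise. *)

(** * Seminorms on row vectors *)

Section RowSeminorm.
Variables (R : realType) (n : nat) (q : 'rV[R]_n -> R).
Hypothesis qD : forall x y, q (x + y) <= q x + q y.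
Hypothesis qZ : forall t x, q (t *: x) = `|t| * q x.

Lemma row_seminorm0 : q 0 = 0.
Proof. by rewrite -(scale0r 0) qZ normr0 mul0r. Qed.

Lemma row_seminormN x : q (- x) = q x.
Proof. by rewrite -scaleN1r qZ normrN1 mul1r. Qed.

Lemma row_seminorm_ge0 x : 0 <= q x.
Proof.
have := qD x (- x); rewrite subrr row_seminorm0 row_seminormN => h; lra.
Qed.

Lemma row_seminorm_sum (I : Type) (r : seq I) (P : pred I) (F : I -> 'rV[R]_n) :
  q (\sum_(i <- r | P i) F i) <= \sum_(i <- r | P i) q (F i).
Proof.
elim/big_ind2 : _ => //; first by rewrite row_seminorm0.
by move=> x1 x2 y1 y2 h1 h2; apply: le_trans (qD _ _) _; exact: lerD.
Qed.

Lemma row_coord_le_norm (x : 'rV[R]_n) i : `|x 0 i| <= `|x|.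
Proof.
rewrite [leRHS]/Num.Def.normr /= mx_normrE; apply/bigmax_geP; right => /=.
by exists (0, i).
Qed.

(** Subadditivity over the coordinates bounds [q] by [S] times the sup norm, so [q] is Lipschitz. *)
Lemma row_seminorm_continuous : continuous q.
Proof.
set S := \sum_i q (delta_mx 0 i).
have S0 : 0 <= S by apply: sumr_ge0 => i _; exact: row_seminorm_ge0.
have qS x : q x <= `|x| * S.
  rewrite [x in q x]row_sum_delta; apply: le_trans (row_seminorm_sum _ _ _) _.
  rewrite /S mulr_sumr; apply: ler_sum => i _.
  by rewrite qZ ler_wpM2r ?row_seminorm_ge0 ?row_coord_le_norm.
have qB x y : `|q x - q y| <= `|x - y| * S.
  apply: le_trans (qS _); rewrite ler_norml; apply/andP; split.
    have := qD (y - x) x; rewrite subrK -(opprB x y) row_seminormN => h; lra.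
  by have := qD (x - y) y; rewrite subrK => h; lra.
move=> x; apply/(@cvgrPdist_lt _ _ _ (nbhs x) _ q (q x)) => e e0.
have d0 : 0 < e / (S + 1) by rewrite divr_gt0 // ltr_wpDl.
near=> y.
apply: le_lt_trans (qB _ _) _.
have xy : `|x - y| < e / (S + 1).
  by near: y; exact: (@cvgr_dist_lt _ _ _ (nbhs x) _ id x).
apply: (@le_lt_trans _ _ (`|x - y| * (S + 1))).
  by rewrite ler_wpM2l // lerDl.
by rewrite -ltr_pdivlMr // ltr_wpDl.
Unshelve. all: by end_near. Qed.

Let supported (J : {set 'I_n}) (a : 'rV[R]_n) :=
  forall i, i \notin J -> a 0 i = 0.

Let free (J : {set 'I_n}) := forall a, supported J a -> q a = 0 -> a = 0.

(* Take a maximal set [J] of coordinates on which [q] is definite: modulo the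
   kernel of [q] every row is supported on [J], and there [q] dominates a
   multiple of the norm by compactness. *)
Lemma row_seminorm_bounded_rep : exists2 M : R, 0 <= M &
  forall a, exists a', q (a - a') = 0 /\ forall i, `|a' 0 i| <= M * q a.
Proof.
have free0 : `[< free finset.set0 >].
  apply/asboolP => a ha _; apply/rowP => i; rewrite mxE ha //.
  by rewrite finset.in_set0.
have [J /asboolP freeJ maxJ] :=
  @arg_maxnP _ finset.set0 (fun J : {set 'I_n} => `[< free J >])
    (fun J => #|J|) free0.
(* By maximality, adding an index [i] outside [J] breaks freeness. The resulting null vector has a
   nonzero [i]-th entry, so modulo the kernel of [q] it can be solved for [delta_mx 0 i]. *)
have reps i : exists b, supported J b /\ q (delta_mx 0 i - b) = 0.
  have [iJ|iJ] := boolP (i \in J).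
    exists (delta_mx 0 i); rewrite subrr row_seminorm0; split => // j jJ.
    by rewrite !mxE eqxx /=; case: eqP => // ji; move: jJ; rewrite ji iJ.
  have /existsNP[a /not_implyP[sa /not_implyP[qa a0]]] : ~ free (i |: J).
      by move=> /asboolP /maxJ; rewrite cardsU1 iJ add1n /= ltnn.
  have ai : a 0 i != 0.
    apply: contra_notN a0 => /eqP ai; apply: freeJ => // j jJ.
    have [->//|ji] := eqVneq j i.
    by apply: sa; rewrite !finset.inE negb_or ji.
  exists (delta_mx 0 i - (a 0 i)^-1 *: a); split.
    move=> j jJ; rewrite !mxE eqxx /=; have [->|ji] := eqVneq j i.
      by rewrite mulVf // subrr.
    by rewrite (sa j) ?mulr0 ?subr0 // !finset.inE negb_or ji.
  by rewrite opprB addrC subrK qZ qa mulr0.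
have /choice[b hb] := reps.
pose S := [set a | supported J a /\ `|a| = 1].
have [M M0 hM] : exists2 M : R, 0 <= M &
    forall a, supported J a -> `|a| <= M * q a.
  (* If the unit sphere [S] is empty, 0 is the only row supported on [J]. Otherwise [q] has a
     positive minimum on [S], whose inverse serves as [M]. *)
  have [S0|/set0P S0] := eqVneq S set0.
    exists 0 => // a sa; have [->|a0] := eqVneq a 0.
      by rewrite normr0 mul0r.
    have : S (`|a|^-1 *: a).
      split; last by rewrite normrZ normfV normr_id mulVf // normr_eq0.
      by move=> j jJ; rewrite mxE sa // mulr0.
    by rewrite S0.
  have cS : compact S.
    apply: bounded_closed_compact.
      by exists 1; split => // x x1 a [_ a1] /=; rewrite a1 ltW.
    have -> : S = (\bigcap_(i in [set i | i \notin J])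
        ((fun a : 'rV[R]_n => a 0 i) @^-1` [set 0])) `&`
        ((fun a : 'rV[R]_n => `|a|) @^-1` [set 1]).
      by apply/seteqP; split => a [h1 h2].
    apply: closedI.
      apply: closed_bigI => i _; apply: closed_comp => //.
      by move=> x _; exact: coord_continuous.
    apply: closed_comp => // x _; exact: norm_continuous.
  have [c cS' hc] := EVT_min_rV S0 cS
    (continuous_subspaceT row_seminorm_continuous).
  have [sc c1] := set_mem cS'.
  have qc : 0 < q c.
    rewrite lt_neqAle row_seminorm_ge0 andbT eq_sym; apply/eqP => qc.
    have c0 := freeJ _ sc qc; move: c1; rewrite c0 normr0 => /esym/eqP.
    by rewrite oner_eq0.
  exists (q c)^-1 => [|a sa]; first by rewrite invr_ge0 ltW.
  have [->|a0] := eqVneq a 0; first by rewrite normr0 row_seminorm0 mulr0.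
  have na : 0 < `|a| by rewrite normr_gt0.
  have : S (`|a|^-1 *: a).
    split; last by rewrite normrZ normfV normr_id mulVf // normr_eq0.
    by move=> j jJ; rewrite mxE sa // mulr0.
  move=> /mem_set/hc; rewrite qZ normfV normr_id mulrC ler_pdivlMr // => h.
  by rewrite mulrC ler_pdivlMr // mulrC.
exists M => // a; pose a' := \sum_i a 0 i *: b i; exists a'.
have sa' : supported J a'.
  by move=> j jJ; rewrite summxE big1 // => i _; rewrite mxE (hb i).1 // mulr0.
have qa' : q (a - a') = 0.
  apply/eqP; rewrite eq_le row_seminorm_ge0 andbT.
  rewrite [a in X in X <= _]row_sum_delta -sumrB.
  apply: le_trans (row_seminorm_sum _ _ _) _; rewrite big1 // => i _.
  by rewrite -scalerBr qZ (hb i).2 mulr0.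
split => // i; apply: le_trans (row_coord_le_norm _ _) _.
apply: le_trans (hM _ sa') _; rewrite ler_wpM2l //.
have := qD (a' - a) a; rewrite subrK -(opprB a a') row_seminormN qa'; lra.
Qed.

End RowSeminorm.

(** * Almost octahedral vectors in a dense rational subspace *)

(** Shifting by [K >= L] makes the coordinates nonnegative; truncating them to the grid of mesh
    [1/m <= d] leaves finitely many possibilities. *)
Lemma rational_net (R : realType) n (L d : R) : 0 < d ->
  exists cs : seq {ffun 'I_n -> rat}, forall a : 'I_n -> R,
    (forall i, `|a i| <= L) ->
    exists2 c, c \in cs & forall i, `|a i - ratr (c i)| <= d.
Proof.
move=> d0; pose m := (Num.truncn d^-1).+1; pose K := (Num.truncn L).+1.
have m0 : 0 < m%:R :> R by rewrite ltr0n.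
have md : m%:R^-1 <= d.
  rewrite -[leRHS]invrK lef_pV2 ?posrE ?invr_gt0 //.
  exact/ltW/truncnS_gt.
have LK : L <= K%:R by exact/ltW/truncnS_gt.
exists [seq [ffun i => (g i : nat)%:R / m%:R - K%:R]
  | g : {ffun 'I_n -> 'I_(m * (K + K)).+1}] => a aL.
pose t i := m%:R * (a i + K%:R).
have ha i : - K%:R <= a i <= K%:R.
  by rewrite -ler_norml; apply: le_trans LK; exact: aL.
have t0 i : 0 <= t i.
  have /andP[h _] := ha i; rewrite mulr_ge0 ?(ltW m0) //; lra.
have tK i : (Num.truncn (t i) < (m * (K + K)).+1)%N.
  rewrite ltnS -(ler_nat R) natrM natrD.
  have /andP[ht _] := truncn_itv (t0 i); apply: le_trans ht _.
  by rewrite ler_wpM2l ?(ltW m0) // lerD2r; have /andP[] := ha i.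
exists [ffun i => (Num.truncn (t i))%:R / m%:R - K%:R].
  apply/mapP; exists [ffun i => Ordinal (tK i)]; first by rewrite mem_enum.
  by apply/ffunP => i; rewrite !ffunE.
move=> i; rewrite ffunE rmorphB fmorph_div /= !ratr_nat.
have /andP[h1 h2] := truncn_itv (t0 i).
apply: le_trans md; rewrite -(ler_pM2l m0) mulfV ?gt_eqF //.
rewrite -[X in X * `|_|](ger0_norm (ltW m0)) -normrM.
have -> : m%:R * (a i - ((Num.truncn (t i))%:R / m%:R - K%:R)) =
    t i - (Num.truncn (t i))%:R.
  by rewrite /t; field; rewrite gt_eqF.
rewrite ger0_norm ?subr_ge0 // lerBlDr addrC natr1; exact: ltW.
Qed.

(* Only finitely many coefficient vectors [c] occur, and the error is additive:
   unlike the conditions defining LOH and OH, this one is open in [nu]. *)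
Definition ell1_witness (R : realType) (A : lmodType rat) (nu : A -> R) n
    (v : {ffun 'I_n -> A}) (cs : seq {ffun 'I_n -> rat}) (k : nat) : Prop :=
  exists w, `|nu w - 1| < k.+1%:R^-1 /\
    forall c, c \in cs ->
      nu (\sum_i c i *: v i) + nu w - k.+1%:R^-1 < nu (\sum_i c i *: v i + w).

Section DenseSubspace.
Variables (R : realType) (W : lmodType R) (D : set W) (p : W -> R).
Variables (A : lmodType rat) (iota : A -> W).
Hypothesis D0 : D 0.
Hypothesis DZD : forall t x y, D x -> D y -> D (t *: x + y).
Hypothesis pD : forall x y, D x -> D y -> p (x + y) <= p x + p y.
Hypothesis pZ : forall t x, D x -> p (t *: x) = `|t| * p x.
Hypothesis iotaD : forall a b, iota (a + b) = iota a + iota b.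
Hypothesis iotaZ : forall c a, iota (c *: a) = ratr c *: iota a.
Hypothesis Diota : forall a, D (iota a).
Hypothesis dense_iota : forall x e, D x -> 0 < e ->
  exists a, p (x - iota a) <= e.

(** The case [n = 1] is LOH and all [n] together are OH. The laws of [p] are assumed on [D] only:
    the norm of the completion is a limit, controlled along Cauchy sequences. *)
Definition octahedral n := forall f : 'I_n -> W, (forall i, D (f i)) ->
  forall e : R, 0 < e -> exists y, D y /\ p y = 1 /\
    forall a : 'I_n -> R,
      (1 - e) * (p (\sum_i a i *: f i) + p y) <= p (\sum_i a i *: f i + y).

Let DZ t x : D x -> D (t *: x).
Proof. by move=> Dx; rewrite -[_ *: _]addr0; exact: DZD. Qed.

Let DD x y : D x -> D y -> D (x + y).
Proof. by move=> Dx Dy; rewrite -[x]scale1r; exact: DZD. Qed.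

Let DB x y : D x -> D y -> D (x - y).
Proof. by move=> Dx Dy; rewrite -scaleN1r addrC; exact: DZD. Qed.

Let Dsum n (a : 'I_n -> R) (f : 'I_n -> W) :
  (forall i, D (f i)) -> D (\sum_i a i *: f i).
Proof. by move=> Df; elim/big_ind : _ => // i _; exact: DZ. Qed.

Let p0 : p 0 = 0.
Proof. by rewrite -(scale0r 0) pZ // normr0 mul0r. Qed.

Let pN x : D x -> p (- x) = p x.
Proof. by move=> Dx; rewrite -scaleN1r pZ // normrN1 mul1r. Qed.

Let pB x y : D x -> D y -> p x - p y <= p (x - y).
Proof.
by move=> Dx Dy; have := pD (DB Dx Dy) Dy; rewrite subrK => h; lra.
Qed.

Let p_ge0 x : D x -> 0 <= p x.
Proof.
move=> Dx; have := pD Dx (DZ (- 1) Dx).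
by rewrite scaleN1r subrr p0 pN // => h; lra.
Qed.

Let psum n (f : 'I_n -> W) :
  (forall i, D (f i)) -> p (\sum_i f i) <= \sum_i p (f i).
Proof.
move=> Df; suff : D (\sum_i f i) /\ p (\sum_i f i) <= \sum_i p (f i) by case.
elim/big_ind2 : _ => //; first by rewrite p0.
move=> x1 x2 y1 y2 [D1 h1] [D2 h2]; split; first exact: DD.
by apply: le_trans (pD D1 D2) _; exact: lerD.
Qed.

Let iota0 : iota 0 = 0.
Proof. by rewrite -(scale0r 0) iotaZ rmorph0 scale0r. Qed.

Let iota_sum n (c : 'I_n -> rat) (v : 'I_n -> A) :
  iota (\sum_i c i *: v i) = \sum_i ratr (c i) *: iota (v i).
Proof.
by rewrite (big_morph iota iotaD iota0); apply: eq_bigr => i _; rewrite iotaZ.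
Qed.

(** As [cs] is finite, the norms of the combinations are bounded by [S], and a relative error [e]
    with [e * (S + 1) = d / 4] becomes an absolute one. Replacing [y] by a nearby rational [w] costs
    [d / 4] in the norm of [w] and again in that of the sum; the total [3 * d / 4] stays below the
    tolerance [d]. *)
Lemma octahedral_ell1_witness n : octahedral n ->
  forall v cs k, ell1_witness (p \o iota) (n := n) v cs k.
Proof.
move=> oct v cs k; pose u c := p (iota (\sum_i (c : {ffun _ -> _}) i *: v i)).
have u0 c : 0 <= u c by exact: p_ge0.
have d0 : 0 < k.+1%:R^-1 :> R by rewrite invr_gt0 ltr0n.
set d : R := k.+1%:R^-1 in d0 *.
pose S := \sum_(c <- cs) u c.
have uS c : c \in cs -> u c <= S.
  by move=> cin; rewrite /S (big_rem c) //= lerDl; exact: sumr_ge0.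
have S0 : 0 <= S by exact: sumr_ge0.
pose e := d / (4 * (S + 1)).
have e0 : 0 < e by rewrite divr_gt0 // mulr_gt0 // ltr_wpDl.
have eS : e * (S + 1) = d / 4 by rewrite /e; field; rewrite gt_eqF // ltr_wpDl.
have [y [Dy [py hy]]] := oct (fun i => iota (v i)) (fun i => Diota _) e e0.
have [w hw] := dense_iota Dy (divr_gt0 d0 (ltr0n _ 4)).
have wy : p (iota w - y) <= d / 4 by rewrite -opprB pN //; exact: DB.
have h1 := pB Dy (Diota w); have h2 := pB (Diota w) Dy.
exists w; rewrite /= -/d; split; first by rewrite ltr_norml; apply/andP; lra.
move=> c cin; have := hy (fun i => ratr (c i)).
rewrite -iota_sum iotaD -/(u c) py.
have Du := Diota (\sum_i c i *: v i).
have := pB (DD Du Dy) (DD Du (Diota w)).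
rewrite opprD addrACA subrr add0r => h3 h4.
have : e * (u c + 1) <= d / 4 by rewrite -eS ler_pM2l // lerD2r; exact: uS.
by move=> h5; rewrite -/(u c); lra.
Qed.

(** Large combinations satisfy the inequality with any unit vector. Bounded ones have bounded
    coefficients modulo the kernel of [p], hence are close to finitely many rational combinations of
    rational vectors; a witness for these, once normalised, serves all. *)
Lemma ell1_witness_octahedral n :
  (forall v cs k, ell1_witness (p \o iota) (n := n) v cs k) -> octahedral n.
Proof.
move=> wit f Df e0 e00; pose e := Num.min e0 1.
have e_gt0 : 0 < e by rewrite lt_min e00 ltr01.
have e1 : e <= 1 by rewrite ge_min lexx orbT.
have ee0 : e <= e0 by rewrite ge_min lexx.
suff [y [Dy [py hy]]] : exists y, D y /\ p y = 1 /\ forall a : 'I_n -> R,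
      (1 - e) * (p (\sum_i a i *: f i) + p y) <= p (\sum_i a i *: f i + y).
  exists y; do 2 split => //; move=> a; apply: le_trans (hy a).
  have pa := p_ge0 (Dsum a Df).
  by rewrite ler_wpM2r ?lerD2l ?lerN2 // addr_ge0 // py.
pose q (a : 'rV[R]_n) := p (\sum_i a 0 i *: f i).
have qD x y : q (x + y) <= q x + q y.
  apply: le_trans (pD (Dsum _ Df) (Dsum _ Df)).
  rewrite /q -big_split le_eqVlt; apply/orP; left; apply/eqP; congr p.
  by apply: eq_bigr => i _; rewrite mxE scalerDl.
have qZ t x : q (t *: x) = `|t| * q x.
  rewrite -pZ; last exact: Dsum.
  rewrite scaler_sumr; congr p.
  by apply: eq_bigr => i _; rewrite mxE scalerA.
have [M M0 hM] := row_seminorm_bounded_rep qD qZ.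
(* Beyond norm [C] the triangle inequality suffices, because [e * C = 2]. Below it, [L] bounds the
   coefficients of a representative, and [h = e / 8] leaves room for an accumulated error of at most
   [7 * h]. *)
pose C := 2 / e; pose L := M * C.
have C0 : 0 < C by rewrite divr_gt0.
have L0 : 0 <= L by rewrite mulr_ge0 // ltW.
have eC : e * C = 2 by rewrite /C; field; rewrite gt_eqF.
pose h := e / 8; have h0 : 0 < h by rewrite divr_gt0.
(* The steps [d] and [h / (S + 1)] are such that replacing [f] by the rational [v], and then the
   coefficients by rational ones, each moves a combination by at most [h]. *)
pose d := h / (n%:R * L + 1).
have nL : 0 < n%:R * L + 1 by rewrite ltr_wpDl // mulr_ge0.
have d0 : 0 < d by rewrite divr_gt0.
have /choice[v hv] : forall i, exists a, p (f i - iota a) <= d.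
  by move=> i; exact: dense_iota.
pose S := \sum_i p (iota (v i)).
have S0 : 0 <= S by apply: sumr_ge0 => i _; exact: p_ge0.
have d'0 : 0 < h / (S + 1) by rewrite divr_gt0 // ltr_wpDl.
have [cs hcs] := rational_net n L d'0.
pose k := Num.truncn h^-1.
have kh : k.+1%:R^-1 < h.
  by rewrite -[ltRHS]invrK ltf_pV2 ?posrE ?invr_gt0 // truncnS_gt.
have [w [w1 hw]] := wit [ffun i => v i] cs k.
move: w1 hw; rewrite /= ltr_norml; set d' : R := k.+1%:R^-1 in kh *.
move=> /andP[w1 w2] hw.
have Dw := Diota w.
(* As [e <= 1], the norm of [w] is close enough to 1 for [w] to be normalised. *)
have pw : 0 < p (iota w) by rewrite /h in kh; lra.
pose y := (p (iota w))^-1 *: iota w.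
have Dy : D y by exact: DZ.
have py : p y = 1.
  by rewrite pZ // ger0_norm ?invr_ge0 ?p_ge0 // mulVf // gt_eqF.
have yw : p (iota w - y) <= h.
  rewrite -[X in X - _]scale1r -scalerBl pZ //.
  rewrite -[X in _ * X]ger0_norm ?p_ge0 // -normrM mulrBl mul1r.
  rewrite mulVf ?gt_eqF //.
  by rewrite ler_norml; apply/andP; lra.
exists y; do 2 split => //; move=> a.
set x := \sum_i a i *: f i.
have Dx : D x by exact: Dsum.
have px := p_ge0 Dx.
rewrite py; have [xC|Cx] := leP (p x) C; last first.
  have Dmy : D (- y) by rewrite -scaleN1r; exact: DZ.
  have := pB Dx Dmy; rewrite pN // opprK py => h3.
  have : e * C <= e * p x by rewrite ler_pM2l // ltW.
  by rewrite eC; lra.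
(* The entries of [a] may be arbitrarily large when the [f i] are dependent modulo the kernel; [a']
   gives the same vector up to norm 0, with entries bounded by [L]. *)
have [a' [qa' ha']] := hM (\row_i a i).
have qx : q (\row_i a i) = p x.
  by rewrite /q; congr p; apply: eq_bigr => i _; rewrite mxE.
have aL i : `|a' 0 i| <= L.
  by apply: le_trans (ha' i) _; rewrite qx ler_wpM2l.
have [c cin hc] := hcs (fun i => a' 0 i) aL.
have := hw c cin; set u := \sum_i _.
have Du := Diota u.
rewrite iotaD => huw.
have iu : iota u = \sum_i ratr (c i) *: iota (v i).
  by rewrite iota_sum; apply: eq_bigr => i _; rewrite ffunE.
have xu : p (x - iota u) <= 2 * h.
  pose x1 := \sum_i a' 0 i *: f i; pose x2 := \sum_i a' 0 i *: iota (v i).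
  have Dx1 : D x1 by exact: Dsum.
  have Dx2 : D x2 by exact: Dsum.
  have h1 : p (x - x1) = 0.
    rewrite -qa'; congr p; rewrite -sumrB; apply: eq_bigr => i _.
    by rewrite !mxE scalerBl.
  have h2 : p (x1 - x2) <= h.
    rewrite -sumrB; under eq_bigr do rewrite -scalerBr.
    apply: le_trans (psum _) _ => [i|]; first exact/DZ/DB.
    apply: (@le_trans _ _ (\sum_(i < n) L * d)).
      apply: ler_sum => i _; rewrite pZ; last exact: DB.
      by apply: ler_pM => //; exact/p_ge0/DB.
    rewrite sumr_const card_ord -mulr_natl mulrA /d.
    rewrite mulrA ler_pdivrMr // mulrC ler_pM2l //; lra.
  have h3 : p (x2 - iota u) <= h.
    rewrite iu -sumrB; under eq_bigr do rewrite -scalerBl.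
    apply: le_trans (psum _) _ => [i|]; first exact/DZ.
    apply: (@le_trans _ _ (\sum_(i < n) h / (S + 1) * p (iota (v i)))).
      apply: ler_sum => i _; rewrite pZ //.
      by rewrite ler_wpM2r ?p_ge0 // hc.
    rewrite -mulr_sumr -/S mulrAC ler_pdivrMr ?ltr_wpDl // ler_pM2l //; lra.
  have := pD (DB Dx Dx1) (DB Dx1 (Diota u)).
  rewrite addrA subrK.
  have := pD (DB Dx1 Dx2) (DB Dx2 (Diota u)).
  by rewrite addrA subrK; lra.
have h1 := pB Dx Du.
have := pB (DD Du Dw) (DD Dx Dy).
have -> : iota u + iota w - (x + y) = - (x - iota u) + (iota w - y).
  by rewrite opprB opprD addrACA.
have Dxu : D (x - iota u) by exact: DB.
have := @pD (- (x - iota u)) (iota w - y).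
rewrite pN // -scaleN1r => /(_ (DZ _ Dxu) (DB Dw Dy)) => h2 h3.
rewrite scaleN1r in h2; rewrite scaleN1r in h3.
have := mulr_ge0 (ltW e_gt0) px.
by rewrite /h in kh xu yw *; lra.
Qed.

End DenseSubspace.

(** * The extension of a seminorm to finitely supported real sequences *)

Lemma cvgn_dist_le (R : realType) (u b : nat -> R) (l : R) :
  (forall k, `|u k - l| <= b k) -> b @ \oo --> 0 -> u @ \oo --> l.
Proof.
move=> ub b0; apply/cvgrPdist_lt => e e0; near=> k.
rewrite distrC; apply: le_lt_trans (ub k) _; near: k.
exact: (@cvgr_lt _ _ \oo _ b 0 b0 e).
Unshelve. all: by end_near. Qed.

Lemma cauchy_seq_cvg (R : realType) (u : nat -> R) :
  (forall e : R, 0 < e -> exists N : nat, forall m n : nat,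
     (N <= m)%N -> (N <= n)%N -> `|u m - u n| < e) ->
  u @ \oo --> limn u.
Proof.
move=> cu.
apply/cauchy_cvgP/cauchy_exP => e e0; have [N hN] := cu e e0.
by exists (u N); exists N => // n /= Nn; rewrite /ball /= hN.
Qed.

Lemma finsupp_poly (K : nzRingType) (p : {poly K}) : finsupp (fun i => p`_i).
Proof. by exists (size p) => n; exact: nth_default. Qed.

Lemma finsupp_polyE (K : nzRingType) (x : nat -> K) :
  finsupp x -> exists p : {poly K}, x = fun i => p`_i.
Proof.
move=> [N hN]; exists (\poly_(i < N) x i); apply/funext => i.
by rewrite coef_poly; case: ltnP => // /hN.
Qed.

(* Finitely supported sequences are encoded as polynomials, which carry the
   module structure that [V] lacks. *)
Definition polyV (p : {poly rat}) : V := exist _ _ (finsupp_poly p).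

Lemma polyV_surj (v : V) : exists p, v = polyV p.
Proof.
case: v => x fx; have [p xp] := finsupp_polyE fx; exists p.
by rewrite /polyV; apply: eq_exist.
Qed.

Section Extension.
Variables (R : realType) (mu : V -> R).
Hypothesis hmu : seminormV mu.

Definition mu_poly (p : {poly rat}) : R := mu (polyV p).

Definition mubar_poly (P : {poly R}) : R := mubar mu (fun i => P`_i).

Lemma mu_poly_ge0 p : 0 <= mu_poly p.
Proof. by case: hmu => h _; exact: h. Qed.

Lemma mu_polyD p q : mu_poly (p + q) <= mu_poly p + mu_poly q.
Proof. by case: hmu => _ [h _]; apply: h => i /=; rewrite coefD. Qed.

Lemma mu_polyZ c p : mu_poly (c *: p) = ratr `|c| * mu_poly p.
Proof. by case: hmu => _ [_ h]; apply: h => i /=; rewrite coefZ. Qed.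

Lemma mu_poly0 : mu_poly 0 = 0.
Proof. by rewrite -(scale0r 0) mu_polyZ normr0 rmorph0 mul0r. Qed.

Lemma mu_polyB p q : `|mu_poly p - mu_poly q| <= mu_poly (p - q).
Proof.
have h1 := mu_polyD (p - q) q; have h2 := mu_polyD (q - p) p.
have h3 : mu_poly (q - p) = mu_poly (p - q).
  by rewrite -opprB -scaleN1r mu_polyZ normrN1 rmorph1 mul1r.
move: h1 h2; rewrite !subrK h3 ler_norml => h1 h2.
by apply/andP; split; lra.
Qed.

Lemma mu_poly_le_coef n (p : {poly rat}) : (size p <= n)%N ->
  mu_poly p <= \sum_(i < n) `|ratr p`_i| * mu_poly 'X^i.
Proof.
move=> sp; rewrite [p in leLHS](_ : p = \sum_(i < n) p`_i *: 'X^i).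
  elim/big_ind2 : _ => [|x1 x2 y1 y2 h1 h2|i _]; first by rewrite mu_poly0.
    by apply: le_trans (mu_polyD _ _) _; exact: lerD.
  by rewrite mu_polyZ ratr_norm.
rewrite -poly_def; apply/polyP => i; rewrite coef_poly; case: ltnP => // ni.
by rewrite nth_default // (leq_trans sp).
Qed.

Lemma muext_polyE (p : {poly rat}) : muext mu (fun i => p`_i) = mu_poly p.
Proof.
rewrite /muext; case: pselect => [h|[]]; last exact: finsupp_poly.
by congr mu; apply: eq_exist.
Qed.

Definition approx_poly k (P : {poly R}) : {poly rat} :=
  \poly_(i < size P) Defs.approx k (fun i => P`_i) i.

Lemma approx_polyE k (P : {poly R}) :
  Defs.approx k (fun i => P`_i) = fun i => (approx_poly k P)`_i.
Proof.
apply/funext => i; rewrite coef_poly; case: ltnP => // Pi.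
by rewrite /Defs.approx nth_default // mulr0 floor0 mul0r.
Qed.

Lemma size_approx_poly k (P : {poly R}) : (size (approx_poly k P) <= size P)%N.
Proof. exact: size_poly. Qed.

Lemma approx_poly_dist k (P : {poly R}) i :
  `|ratr (approx_poly k P)`_i - P`_i| <= k.+1%:R^-1.
Proof.
rewrite -[(approx_poly k P)`_i]/((fun i => (approx_poly k P)`_i) i).
rewrite -approx_polyE.
rewrite /Defs.approx fmorph_div /= ratr_int ratr_nat.
have k0 : 0 < k.+1%:R :> R by [].
rewrite -(ler_pM2l k0) mulfV ?gt_eqF //.
rewrite -[X in X * `|_|](ger0_norm (ltW k0)) -normrM mulrBr mulrC.
rewrite divfK ?gt_eqF //.
set x := k.+1%:R * _.
have h1 := floor_le x; have h2 := floorD1_gt x.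
rewrite intrD in h2.
by rewrite distrC ger0_norm ?subr_ge0 // lerBlDr addrC ltW.
Qed.

Lemma approx_poly_cvg (P : {poly R}) i :
  (fun k => ratr (approx_poly k P)`_i : R) @ \oo --> P`_i.
Proof.
by apply: cvgn_dist_le (fun k => approx_poly_dist k P i) _; exact: cvg_harmonic.
Qed.

Lemma mu_poly_cvg0 n (p : nat -> {poly rat}) :
  (forall k, (size (p k) <= n)%N) ->
  (forall i, (fun k => ratr (p k)`_i : R) @ \oo --> 0) ->
  mu_poly (p k) @[k --> \oo] --> 0.
Proof.
move=> sp hp.
pose b k := \sum_(i < n) `|ratr (p k)`_i : R| * mu_poly 'X^i.
apply: (@cvgn_dist_le _ _ b).
  by move=> k; rewrite subr0 ger0_norm ?mu_poly_ge0 //; exact: mu_poly_le_coef.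
have -> : 0 = \sum_(i < n) 0 * mu_poly 'X^i.
  by rewrite big1 // => i _; rewrite mul0r.
apply: cvg_big => [|i _]; first exact: add_continuous.
apply: cvgM; last exact: cvg_cst.
by rewrite -[X in _ --> X](@normr0 _ R); apply: cvg_norm; exact: hp.
Qed.

(** The value of [limn] is informative only once convergence is known. Two late approximations
    differ by at most [2 * d] in each of the [size P] coefficients, so their seminorms form a Cauchy
    sequence. *)
Lemma mubar_poly_approx_cvg P :
  mu_poly (approx_poly k P) @[k --> \oo] --> mubar_poly P.
Proof.
rewrite /mubar_poly /mubar.
under [X in limn X]funext => k do rewrite approx_polyE muext_polyE.
apply: cauchy_seq_cvg => e e0.
pose S := \sum_(i < size P) mu_poly 'X^i.
have S0 : 0 <= S by apply: sumr_ge0 => i _; exact: mu_poly_ge0.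
pose d := e / (4 * (S + 1)).
have d0 : 0 < d by rewrite divr_gt0 // mulr_gt0 // ltr_wpDl.
exists (Num.truncn d^-1) => m n hm hn.
have near k : (Num.truncn d^-1 <= k)%N ->
    forall i, `|ratr (approx_poly k P)`_i - P`_i| <= d.
  move=> hk i; apply: le_trans (approx_poly_dist _ _ _) _.
  rewrite -[leRHS]invrK lef_pV2 ?posrE ?invr_gt0 //.
  apply: le_trans (ltW (truncnS_gt _)) _.
  by rewrite ler_nat ltnS.
apply: le_lt_trans (mu_polyB _ _) _.
have sz : (size (approx_poly m P - approx_poly n P)%R <= size P)%N.
  by rewrite (leq_trans (size_polyD _ _)) // size_polyN geq_max
    !size_approx_poly.
apply: le_lt_trans (mu_poly_le_coef sz) _.
apply: (@le_lt_trans _ _ (\sum_(i < size P) 2 * d * mu_poly 'X^i)).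
  apply: ler_sum => i _; rewrite ler_wpM2r ?mu_poly_ge0 // coefB rmorphB /=.
  have := near m hm i; have := near n hn i; rewrite !ler_norml.
  by move=> /andP[? ?] /andP[? ?]; apply/andP; split; lra.
rewrite -mulr_sumr -/S /d.
have -> : 2 * (e / (4 * (S + 1))) * S = e * (S / (2 * (S + 1))).
  by field; rewrite gt_eqF // ltr_wpDl.
rewrite -[ltRHS]mulr1 ltr_pM2l // ltr_pdivrMr.
  by rewrite mul1r; lra.
by rewrite mulr_gt0 // ltr_wpDl.
Qed.

(** Any rational sequence of bounded degree converging coefficientwise computes the extension. This
    is what yields the seminorm laws, since sums and multiples of approximations are not the
    approximations of the sum or multiple. *)
Lemma mubar_poly_cvg n (p : nat -> {poly rat}) (P : {poly R}) :
  (forall k, (size (p k) <= n)%N) ->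
  (forall i, (fun k => ratr (p k)`_i : R) @ \oo --> P`_i) ->
  mu_poly (p k) @[k --> \oo] --> mubar_poly P.
Proof.
move=> sp hp.
have -> : (fun k => mu_poly (p k)) =
    (fun k => (mu_poly (p k) - mu_poly (approx_poly k P)) +
      mu_poly (approx_poly k P)).
  by apply/funext => k; rewrite subrK.
rewrite -[mubar_poly P]add0r; apply: cvgD; last exact: mubar_poly_approx_cvg.
apply: (@cvgn_dist_le _ _ (fun k => mu_poly (p k - approx_poly k P))).
  by move=> k; rewrite subr0; exact: mu_polyB.
apply: (@mu_poly_cvg0 (maxn n (size P))) => [k|i].
  rewrite (leq_trans (size_polyD _ _)) // size_polyN geq_max !leq_max sp.
  by rewrite size_approx_poly orbT.
under eq_fun do rewrite coefB rmorphB.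
by rewrite -(subrr P`_i); apply: cvgB; [exact: hp|exact: approx_poly_cvg].
Qed.

Lemma mubar_poly_ge0 P : 0 <= mubar_poly P.
Proof.
apply: (ler_cvg_to (cvg_cst 0) (@mubar_poly_approx_cvg P)).
by near=> k; exact: mu_poly_ge0.
Unshelve. all: by end_near. Qed.

Lemma mubar_polyD P Q : mubar_poly (P + Q) <= mubar_poly P + mubar_poly Q.
Proof.
have h :
    mu_poly (approx_poly k P + approx_poly k Q) @[k --> \oo] -->
    mubar_poly (P + Q).
  apply: (@mubar_poly_cvg (maxn (size P) (size Q))) => [k|i].
    by rewrite (leq_trans (size_polyD _ _)) // geq_max !leq_max
      !size_approx_poly orbT.
  under eq_fun do rewrite coefD rmorphD.
  by rewrite coefD; apply: cvgD; exact: approx_poly_cvg.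
apply: (ler_cvg_to h
  (cvgD (@mubar_poly_approx_cvg P) (@mubar_poly_approx_cvg Q))).
by near=> k; exact: mu_polyD.
Unshelve. all: by end_near. Qed.

Lemma mubar_polyZ t P : mubar_poly (t *: P) = `|t| * mubar_poly P.
Proof.
(* The real scalar is approximated as a constant polynomial; the products then have two limits,
   which must agree. *)
pose c k : rat := (approx_poly k t%:P)`_0.
have hc : (fun k => ratr (c k) : R) @ \oo --> t.
  by have := @approx_poly_cvg t%:P 0; rewrite coefC.
have h1 : mu_poly (c k *: approx_poly k P) @[k --> \oo] --> mubar_poly (t *: P).
  apply: (@mubar_poly_cvg (size P)) => [k|i].
    by rewrite (leq_trans (size_scale_leq _ _)) // size_approx_poly.
  under eq_fun do rewrite coefZ rmorphM.
  by rewrite coefZ; apply: cvgM => //; exact: approx_poly_cvg.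
have h2 : mu_poly (c k *: approx_poly k P) @[k --> \oo] --> `|t| * mubar_poly P.
  under eq_fun do rewrite mu_polyZ ratr_norm.
  by apply: cvgM; [exact: cvg_norm|exact: mubar_poly_approx_cvg].
exact: cvg_unique h1 h2.
Qed.

Lemma mubar_poly_ratr p : mubar_poly (map_poly ratr p) = mu_poly p.
Proof.
have h1 : mu_poly p @[_ --> \oo] --> mubar_poly (map_poly ratr p).
  by apply: (@mubar_poly_cvg (size p)) => // i;
    rewrite coef_map; exact: cvg_cst.
have h2 : mu_poly p @[_ --> \oo] --> mu_poly p by exact: cvg_cst.
exact: cvg_unique h1 h2.
Qed.

Lemma mubar_poly_dense (P : {poly R}) e : 0 < e ->
  exists p, mubar_poly (P - map_poly ratr p) <= e /\
    forall i, `|P`_i - ratr p`_i| <= e.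
Proof.
move=> e0.
pose S := \sum_(i < size P) mubar_poly 'X^i.
have S0 : 0 <= S by apply: sumr_ge0 => i _; exact: mubar_poly_ge0.
pose d := e / (S + 1).
have d0 : 0 < d by rewrite divr_gt0 // ltr_wpDl.
have de : d <= e by rewrite ler_pdivrMr ?ltr_wpDl // ler_peMr ?(ltW e0) //; lra.
pose k := Num.truncn d^-1; exists (approx_poly k P).
have near i : `|P`_i - ratr (approx_poly k P)`_i| <= d.
  rewrite distrC; apply: le_trans (approx_poly_dist _ _ _) _.
  rewrite -[leRHS]invrK lef_pV2 ?posrE ?invr_gt0 //.
  exact/ltW/truncnS_gt.
split; last by move=> i; exact: le_trans (near i) de.
set Q := P - _.
have -> : Q = \sum_(i < size P) Q`_i *: 'X^i.
  rewrite -poly_def; apply/polyP => i; rewrite coef_poly; case: ltnP => // ni.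
  rewrite coefB coef_map /= !nth_default ?subr0 ?rmorph0 ?subr0 //.
  exact: leq_trans (size_approx_poly _ _) ni.
apply: (@le_trans _ _ (\sum_(i < size P) d * mubar_poly 'X^i)); last first.
  by rewrite -mulr_sumr -/S /d mulrAC ler_pdivrMr ?ltr_wpDl // ler_pM2l //; lra.
elim/big_ind2 : _ => [|x1 x2 y1 y2 h1 h2|i _].
- by rewrite -(scale0r 0) mubar_polyZ normr0 mul0r.
- by apply: le_trans (mubar_polyD _ _) _; exact: lerD.
- by rewrite mubar_polyZ ler_wpM2r ?mubar_poly_ge0 // coefB coef_map.
Qed.

End Extension.

(** * The completion *)

Section Completion.
Variables (R : realType) (mu : V -> R).
Hypothesis hmu : seminormV mu.

Local Notation W := (nat -> {poly R}).
Local Notation N := (mubar_poly mu).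

Definition seq_of (s : W) : nat -> nat -> R := fun k j => (s k)`_j.

(** The image of a rational vector in the completion, as a constant Cauchy sequence. *)
Definition const_poly (p : {poly rat}) : W := fun=> map_poly ratr p.

Let D : set W := [set s | Xmu mu (seq_of s)].
Let p (s : W) : R := Xnorm mu (seq_of s).

Let N0 : N 0 = 0.
Proof. by rewrite -(scale0r 0) (mubar_polyZ hmu) normr0 mul0r. Qed.

Let NN P : N (- P) = N P.
Proof. by rewrite -scaleN1r (mubar_polyZ hmu) normrN1 mul1r. Qed.

Let NB P Q : `|N P - N Q| <= N (P - Q).
Proof.
have h1 := mubar_polyD hmu (P - Q) Q; have h2 := mubar_polyD hmu (Q - P) P.
have h3 : N (Q - P) = N (P - Q) by rewrite -opprB NN.
move: h1 h2; rewrite !subrK h3 ler_norml => h1 h2.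
by apply/andP; split; lra.
Qed.

Lemma Xmu_seq_of x : Xmu mu x -> exists s, x = seq_of s.
Proof.
move=> [fx _]; have /choice[s hs] := fun k => finsupp_polyE (fx k).
by exists s; apply/funext => k; rewrite hs.
Qed.

Lemma Xmu_seq_ofP s : Xmu mu (seq_of s) <->
  forall e : R, 0 < e -> exists M : nat, forall m n : nat,
    (M <= m)%N -> (M <= n)%N -> N (s m - s n) < e.
Proof.
have E m n : mubar mu (fun i => seq_of s m i - seq_of s n i) = N (s m - s n).
  by rewrite /mubar_poly; congr mubar; apply/funext => i; rewrite coefB.
split=> [[_ h] e /h[M hM]|h].
  by exists M => m n mM nM; rewrite -E; exact: hM.
split=> [n|e /h[M hM]]; first exact: finsupp_poly.
by exists M => m n mM nM; rewrite E; exact: hM.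
Qed.

Let p_cvg s : D s -> N (s k) @[k --> \oo] --> p s.
Proof.
move=> /Xmu_seq_ofP Ds; apply: cauchy_seq_cvg => e /Ds[M hM].
by exists M => m n mM nM; apply: le_lt_trans (NB _ _) _; exact: hM.
Qed.

Let DZD t x y : D x -> D y -> D (t *: x + y).
Proof.
move=> /Xmu_seq_ofP Dx /Xmu_seq_ofP Dy; apply/Xmu_seq_ofP => e e0.
have t0 : 0 < `|t| + 1 by rewrite ltr_wpDl.
have [M1 h1] := Dx _ (divr_gt0 e0 (mulr_gt0 (ltr0n _ 2) t0)).
have [M2 h2] := Dy _ (divr_gt0 e0 (ltr0n _ 2)).
exists (maxn M1 M2) => m n; rewrite !geq_max => /andP[m1 m2] /andP[n1 n2].
have -> : (t *: x + y) m - (t *: x + y) n = t *: (x m - x n) + (y m - y n).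
  by rewrite scalerBr addrACA -opprD.
apply: le_lt_trans (mubar_polyD hmu _ _) _; rewrite (mubar_polyZ hmu).
have := h2 m n m2 n2; have := h1 m n m1 n1.
rewrite ltr_pdivlMr ?mulr_gt0 // => h3 h4.
have := mubar_poly_ge0 hmu (x m - x n) => h5.
have h6 : `|t| * N (x m - x n) <= (`|t| + 1) * N (x m - x n).
  by rewrite ler_wpM2r // lerDl.
lra.
Qed.

Let pD x y : D x -> D y -> p (x + y) <= p x + p y.
Proof.
move=> Dx Dy; have Dxy := DZD 1 Dx Dy; rewrite scale1r in Dxy.
apply: (ler_cvg_to (p_cvg Dxy) (cvgD (p_cvg Dx) (p_cvg Dy))).
by near=> k; exact: (mubar_polyD hmu).
Unshelve. all: by end_near. Qed.

Let Dconst q : D (const_poly q).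
Proof.
by apply/Xmu_seq_ofP => e e0; exists 0%N => m n _ _; rewrite subrr N0.
Qed.

Let D0 : D 0.
Proof.
by apply/Xmu_seq_ofP => e e0; exists 0%N => m n _ _; rewrite subrr N0.
Qed.

Let pZ t x : D x -> p (t *: x) = `|t| * p x.
Proof.
move=> Dx; have Dtx := DZD t Dx D0; rewrite addr0 in Dtx.
have h : N ((t *: x) k) @[k --> \oo] --> `|t| * p x.
  have -> : (fun k => N ((t *: x) k)) = fun k => `|t| * N (x k).
    by apply/funext => k; exact: (mubar_polyZ hmu).
  by apply: cvgM; [exact: cvg_cst|exact: p_cvg].
exact: cvg_unique (p_cvg Dtx) h.
Qed.

Let p_const q : p (const_poly q) = mu_poly mu q.
Proof.
have h : N (const_poly q k) @[k --> \oo] --> N (map_poly ratr q).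
  apply: (@cvg_cst _ (N (map_poly ratr q))).
by rewrite -(mubar_poly_ratr hmu); exact: cvg_unique (p_cvg (Dconst q)) h.
Qed.

(** A late term of the Cauchy sequence is within [e / 2] of the point it represents, and rounding
    the coefficients of that term costs another [e / 2]. *)
Let dense_const x e : D x -> 0 < e -> exists q, p (x - const_poly q) <= e.
Proof.
move=> Dx e0; have /Xmu_seq_ofP Dx' := Dx.
have e20 : 0 < e / 2 by rewrite divr_gt0.
have [M hM] := Dx' _ e20.
have [q [hq _]] := mubar_poly_dense hmu (x M) e20.
exists q; have Dxq := DZD (- 1) (Dconst q) Dx.
rewrite scaleN1r addrC in Dxq.
apply: (cvgr_to_le (p_cvg Dxq)); near=> k.
have Mk : (M <= k)%N by near: k; exists M.
have := hM k M Mk (leqnn M).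
have := mubar_polyD hmu (x k - x M) (x M - map_poly ratr q).
rewrite addrA subrK => h1 h2; apply: le_trans h1 _; lra.
Unshelve. all: by end_near. Qed.

Lemma XcombE n (a : 'I_n -> R) (s : 'I_n -> W) :
  Xcomb a (fun i => seq_of (s i)) = seq_of (\sum_i a i *: s i).
Proof.
apply/funext => k; apply/funext => j.
rewrite /Xcomb /seq_of fct_sumE coef_sum; apply: eq_bigr => i _.
by rewrite coefZ.
Qed.

Lemma XlinE t (x y : W) : Xlin t (seq_of x) (seq_of y) = seq_of (t *: x + y).
Proof.
by apply/funext => k; apply/funext => j; rewrite /Xlin /seq_of coefD coefZ.
Qed.

Let constD a b : const_poly (a + b) = const_poly a + const_poly b.
Proof. by apply/funext => k; rewrite /const_poly rmorphD. Qed.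

Let constZ c a : const_poly (c *: a) = ratr c *: const_poly a.
Proof. by apply/funext => k; rewrite /const_poly map_polyZ. Qed.

Lemma OH_octahedral : OH mu <-> forall n, octahedral D p n.
Proof.
split=> [oh n f Df e e0|oct n f Df e e0].
  have [y [Dy [py hy]]] := oh n (fun i => seq_of (f i)) Df e e0.
  have [y' yy'] := Xmu_seq_of Dy; subst y.
  exists y'; do 2 split => //; move=> a; have := hy a.
  by rewrite XcombE XlinE scale1r.
have /choice[s hs] := fun i => Xmu_seq_of (Df i).
have fs : f = fun i => seq_of (s i) by apply/funext.
have Ds i : D (s i) by rewrite /D /= -hs.
have [y [Dy [py hy]]] := oct n s Ds e e0.
exists (seq_of y); do 2 split => //; move=> a.
by rewrite fs XcombE XlinE scale1r; exact: hy.
Qed.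

(** Combinations of a one-element family are multiples [t *: x], and homogeneity matches their norm
    with the term in [|t|] of LOH. *)
Lemma LOH_octahedral : LOH mu <-> octahedral D p 1.
Proof.
split=> [loh f Df e e0|oct e e0 x Dx].
  have [y [Dy [py hy]]] := loh e e0 _ (Df ord0).
  have [y' yy'] := Xmu_seq_of Dy; subst y.
  exists y'; do 2 split => //; move=> a; have := hy (a ord0).
  by rewrite XlinE big_ord1 pZ //; exact: Df.
have [s hs] := Xmu_seq_of Dx; subst x.
have [y [Dy [py hy]]] := oct (fun=> s) (fun=> Dx) e e0.
exists (seq_of y); do 2 split => //; move=> t.
by have := hy (fun=> t); rewrite XlinE big_ord1 pZ.
Qed.

Lemma octahedralP n : octahedral D p n <->
  forall v cs k, ell1_witness (mu_poly mu) (n := n) v cs k.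
Proof.
have E : p \o const_poly = mu_poly mu by apply/funext => q /=.
rewrite -E; split.
- exact: (@octahedral_ell1_witness _ _ D p _ const_poly).
- exact: (@ell1_witness_octahedral _ _ D p _ const_poly).
Qed.

Lemma OHP : OH mu <->
  forall n v cs k, ell1_witness (mu_poly mu) (n := n) v cs k.
Proof.
rewrite OH_octahedral; split=> h n; first exact/octahedralP.
by apply/octahedralP; exact: h.
Qed.

Lemma LOHP : LOH mu <->
  forall v cs k, ell1_witness (mu_poly mu) (n := 1) v cs k.
Proof. by rewrite LOH_octahedral octahedralP. Qed.

End Completion.

(** * The upper bound *)

(* [pointwise_cvgP] requires a topology on the index type, which [V] lacks. *)
Lemma ptws_cvgP (I : Type) (T : topologicalType) (F : set_system {ptws I -> T})
    (f : {ptws I -> T}) : Filter F ->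
  F --> f <-> forall i, (fun g : {ptws I -> T} => g i) @ F --> f i.
Proof.
move=> FF; rewrite cvg_sup.
have surj i : (fun g : I -> T => g i) @` setT = setT.
  by apply/seteqP; split => // y _; exists (fun=> y).
split=> h i; have := h i; rewrite cvg_image //.
  apply: cvg_trans => A /= [B FB <-].
  by apply: (@filterS _ F _ B) => // g Bg; exists g.
move=> hi A /= /hi FA; exists ((fun g : I -> T => g i) @^-1` A) => //.
exact: image_preimage.
Qed.

Lemma RV_eval_continuous (R : realType) (v : V) :
  continuous (fun mu : RV R => mu v).
Proof.
move=> mu.
have /ptws_cvgP h : nbhs (mu : {ptws V -> R}) --> (mu : {ptws V -> R}).
  exact: cvg_id.
exact: h.
Qed.

Lemma RV_continuous (R : realType) (Z : topologicalType) (f : Z -> RV R) :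
  (forall v, continuous (fun z => f z v)) -> continuous f.
Proof. by move=> cf z; apply/ptws_cvgP => v; exact: cf. Qed.

Lemma open_continuous_lt (R : realType) (T : topologicalType) (f g : T -> R) :
  continuous f -> continuous g -> open [set x | f x < g x].
Proof.
move=> cf cg; rewrite (_ : [set _ | _] = (g \- f) @^-1` [set y | 0 < y]).
  apply: open_comp; last exact: open_gt.
  by move=> x _; apply: cvgB; [exact: cg|exact: cf].
by apply/seteqP; split => x /=; rewrite subr_gt0.
Qed.

Lemma open_all_seq (T : topologicalType) (I : eqType) (s : seq I)
    (P : I -> set T) : (forall i, open (P i)) ->
  open [set x | forall i, i \in s -> P i x].
Proof.
move=> oP; elim: s => [|i s IH].
  rewrite (_ : [set _ | _] = setT); first exact: openT.
  by apply/seteqP; split.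
rewrite (_ : [set _ | _] = P i `&` [set x | forall i, i \in s -> P i x]).
  exact: openI.
apply/seteqP; split => x /= => [h|[h1 h2] j].
  by split=> [|j js]; apply: h; rewrite in_cons ?eqxx // js orbT.
by rewrite in_cons => /orP[/eqP->|/h2].
Qed.

(** The set is a union over [w] of finite intersections of strict inequalities between continuous
    functions. *)
Lemma open_ell1_witness (R : realType) (T : topologicalType) (A : lmodType rat)
    (h : T -> A -> R) n (v : {ffun 'I_n -> A}) cs k :
  (forall a, continuous (h^~ a)) ->
  open [set t | ell1_witness (h t) v cs k].
Proof.
move=> ch; pose u (c : {ffun 'I_n -> rat}) := \sum_i c i *: v i.
rewrite (_ : [set _ | _] = \bigcup_w
  ([set t | `|h t w - 1| < k.+1%:R^-1] `&`
   [set t | forall c, c \in cs ->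
     h t (u c) + h t w - k.+1%:R^-1 < h t (u c + w)])).
  apply: bigcup_open => w _; apply: openI.
    apply: open_continuous_lt; last exact: cst_continuous.
    move=> t; apply: cvg_norm; apply: cvgB; last exact: cst_continuous.
    exact: ch.
  apply: open_all_seq => c; apply: open_continuous_lt; last exact: ch.
  move=> t; apply: cvgB; last exact: cst_continuous.
  by apply: cvgD; exact: ch.
by apply/seteqP; split => t /= => [[w hw]|[w _ hw]]; exists w.
Qed.

Lemma open_ell1_witness_mu (R : realType) n
    (v : {ffun 'I_n -> {poly rat}}) cs k :
  open [set mu : RV R | ell1_witness (mu_poly mu) v cs k].
Proof.
by apply: open_ell1_witness => p; exact: RV_eval_continuous.
Qed.

Lemma bigcap_countType (X : Type) (T : countType) (G : T -> set X)
    (P : set X -> Prop) :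
  P setT -> (forall t, P (G t)) ->
  exists F : nat -> set X, (forall i, P (F i)) /\
    \bigcap_i F i = [set x | forall t, G t x].
Proof.
move=> PT PG; exists (fun i => if unpickle i is Some t then G t else setT).
split=> [i|]; first by case: unpickle.
apply/seteqP; split => [x h t|x h i _]; last by case: unpickle.
by have := h (pickle t) I; rewrite pickleK.
Qed.

(** The witness conditions are indexed by rational data, hence by a countable type, and each is
    open. *)
Lemma Gdelta_LOH (R : realType) : exists G : nat -> set (RV R),
  (forall i, open (G i)) /\
  forall mu, Pset R mu -> LOH mu <-> (\bigcap_i G i) mu.
Proof.
pose T := ({ffun 'I_1 -> {poly rat}} * seq {ffun 'I_1 -> rat} * nat)%type.
have [G [oG GE]] := @bigcap_countType (RV R) T
  (fun t => [set mu : RV R | ell1_witness (mu_poly mu) t.1.1 t.1.2 t.2]) open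
  openT (fun t => @open_ell1_witness_mu _ _ _ _ _).
exists G; split=> // mu hmu; rewrite GE (LOHP hmu) /=.
by split=> [h [[v cs] k]|h v cs k]; [exact: h|exact: (h (v, cs, k))].
Qed.

Lemma Gdelta_OH (R : realType) : exists G : nat -> set (RV R),
  (forall i, open (G i)) /\
  forall mu, Pset R mu -> OH mu <-> (\bigcap_i G i) mu.
Proof.
pose T := {n : nat &
  ({ffun 'I_n -> {poly rat}} * seq {ffun 'I_n -> rat} * nat)%type}.
have [G [oG GE]] := @bigcap_countType (RV R) T
  (fun t => [set mu : RV R | ell1_witness (mu_poly mu)
     (tagged t).1.1 (tagged t).1.2 (tagged t).2]) open
  openT (fun t => @open_ell1_witness_mu _ _ _ _ _).
exists G; split=> // mu hmu; rewrite GE (OHP hmu) /=.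
split=> [h [n [[v cs] k]]|h n v cs k]; first exact: h.
exact: (h (existT _ n (v, cs, k))).
Qed.

(** * A norm interpolating between sup-norm and sum-norm steps *)

Section MixedNorm.
Variable R : realType.
Implicit Types (a x y : nat -> R) (n : nat).

(* The weight [a n] interpolates between adjoining the [n]-th coordinate in
   the [ell_infinity] sense ([a n = 0]) and in the [ell_1] sense
   ([a n = 1]). *)
Fixpoint mixed_norm a x n : R :=
  if n is m.+1 then
    let u := mixed_norm a x m in
    Num.max (Num.max u `|x m|) (a m * (u + `|x m|))
  else 0.

Section Weights.
Variable a : nat -> R.
Hypothesis a01 : forall n, 0 <= a n <= 1.

Let a0 n : 0 <= a n.
Proof. by have /andP[] := a01 n. Qed.

Lemma mixed_norm_ge0 x n : 0 <= mixed_norm a x n.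
Proof. by elim: n => //= n IH; rewrite !le_max IH. Qed.

Lemma mixed_norm_coord x n i : (i < n)%N -> `|x i| <= mixed_norm a x n.
Proof.
elim: n => // n IH; rewrite ltnS leq_eqVlt => /orP[/eqP->|/IH h] /=.
  by rewrite !le_max lexx orbT.
by rewrite !le_max h.
Qed.

Lemma eq_mixed_norm x y n :
  (forall i, (i < n)%N -> x i = y i) -> mixed_norm a x n = mixed_norm a y n.
Proof.
elim: n => //= n IH xy; rewrite IH ?xy // => i lt_in.
by apply: xy; exact: ltnW.
Qed.

(** At a zero coordinate the step only compares [u] with [a n * u], and [a n <= 1]. Hence the
    cut-off used for a finitely supported vector does not matter. *)
Lemma mixed_norm_stable x m n : (m <= n)%N ->
  (forall i, (m <= i)%N -> x i = 0) -> mixed_norm a x n = mixed_norm a x m.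
Proof.
move=> + x0; elim: n => [|n IH]; first by rewrite leqn0 => /eqP->.
rewrite leq_eqVlt => /orP[/eqP->//|]; rewrite ltnS => mn /=.
rewrite IH // x0 // normr0 addr0.
have := mixed_norm_ge0 x m; set u := mixed_norm _ _ _ => u0.
rewrite (max_idPl u0); apply/max_idPl.
by have /andP[_ ?] := a01 n; rewrite ler_piMl.
Qed.

Lemma mixed_normD x y n : mixed_norm a (fun i => x i + y i) n <=
  mixed_norm a x n + mixed_norm a y n.
Proof.
elim: n => /= [|n IH]; first by rewrite addr0.
set u := mixed_norm a x n in IH *; set v := mixed_norm a y n in IH *.
rewrite !ge_max -andbA; apply/and3P; split.
- by apply: le_trans IH _; apply: lerD; rewrite !le_max lexx.
- apply: le_trans (ler_normD _ _) _.
  by apply: lerD; rewrite !le_max lexx orbT.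
- apply: (@le_trans _ _ (a n * (u + `|x n|) + a n * (v + `|y n|))).
    rewrite -mulrDr ler_wpM2l // addrACA lerD //; exact: ler_normD.
  by apply: lerD; rewrite le_max lexx orbT.
Qed.

Lemma mixed_normZ t x n :
  mixed_norm a (fun i => t * x i) n = `|t| * mixed_norm a x n.
Proof.
elim: n => /= [|n ->]; first by rewrite mulr0.
by rewrite normrM -mulrDr mulrCA -!maxr_pMr.
Qed.

(** From [m] on every step is a plain maximum, so changing the [m]-th coordinate can only bring in
    its new absolute value. *)
Lemma mixed_norm_update x y m n : (m < n)%N ->
  (forall i, (m <= i)%N -> a i = 0) -> (forall i, i != m -> y i = x i) ->
  mixed_norm a y n <= Num.max (mixed_norm a x n) `|y m|.
Proof.
move=> + am yx; elim: n => // n IH.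
rewrite ltnS leq_eqVlt => /orP[/eqP <-|mn] /=.
  rewrite (@eq_mixed_norm y x m) => [|i im]; last by rewrite yx // ltn_eqF.
  rewrite am // !mul0r !ge_max !le_max lexx mixed_norm_ge0 lexx /= !orbT //.
rewrite am ?(ltnW mn) // !mul0r yx ?gtn_eqF // !ge_max; apply/andP; split.
  apply/andP; split; last by rewrite !le_max lexx orbT.
  by apply: le_trans (IH mn) _; rewrite ge_max !le_max !lexx !orbT.
by rewrite !le_max mixed_norm_ge0.
Qed.

End Weights.

(** The cut-off is chosen from [v] alone, not from [a], so for fixed [v] the value is a fixed finite
    recursion in the weights; this gives continuity in [a]. *)
Definition mixedV a (v : V) : R :=
  mixed_norm a (fun i => ratr (sval v i)) (projT1 (cid (svalP v))).

(** * The space defined by a weight sequence *)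

Section MixedSpace.
Variable a : nat -> R.
Hypothesis a01 : forall n, 0 <= a n <= 1.

Lemma mixedVE v n : (forall i, (n <= i)%N -> sval v i = 0) ->
  mixedV a v = mixed_norm a (fun i => ratr (sval v i)) n.
Proof.
move=> vn; rewrite /mixedV; case: cid => m /= vm.
have x0 k : (forall i, (k <= i)%N -> sval v i = 0) ->
    forall i, (k <= i)%N -> ratr (sval v i) = 0 :> R.
  by move=> h i /h ->; rewrite rmorph0.
rewrite -(mixed_norm_stable a01 (leq_maxl m n) (x0 _ vm)).
by rewrite -(mixed_norm_stable a01 (leq_maxr m n) (x0 _ vn)).
Qed.

Lemma nu_mixedV (p : {poly rat}) n : (size p <= n)%N ->
  mu_poly (mixedV a) p = mixed_norm a (fun i => ratr p`_i) n.
Proof.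
by move=> pn; apply: mixedVE => i ni /=; rewrite nth_default // (leq_trans pn).
Qed.

Lemma mixedV_seminorm : seminormV (mixedV a).
Proof.
have E p : mixedV a (polyV p) = mu_poly (mixedV a) p by [].
split=> [v|]; first exact: mixed_norm_ge0.
split=> [v w u uvw|q v u uqv].
  have [p vp] := polyV_surj v; have [r wr] := polyV_surj w.
  have -> : u = polyV (p + r).
    case: u uvw => u fu /= uvw; apply: eq_exist; apply/funext => i.
    by rewrite uvw vp wr coefD.
  pose n := maxn (size p) (size r).
  have sp : (size p <= n)%N by exact: leq_maxl.
  have sr : (size r <= n)%N by exact: leq_maxr.
  have spr : (size (p + r)%R <= n)%N.
    by rewrite (leq_trans (size_polyD _ _)) // geq_max sp.
  rewrite vp wr !E (nu_mixedV sp) (nu_mixedV sr) (nu_mixedV spr).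
  rewrite (@eq_mixed_norm _ _ (fun i => ratr p`_i + ratr r`_i)).
    exact: mixed_normD.
  by move=> i _; rewrite coefD rmorphD.
have [p vp] := polyV_surj v.
have -> : u = polyV (q *: p).
  case: u uqv => u fu /= uqv; apply: eq_exist; apply/funext => i.
  by rewrite uqv vp coefZ.
rewrite vp !E (@nu_mixedV p _ (leqnn _)) (nu_mixedV (size_scale_leq _ _)).
rewrite (@eq_mixed_norm _ _ (fun i => ratr q * ratr p`_i)).
  by rewrite mixed_normZ ratr_norm.
by move=> i _; rewrite coefZ rmorphM.
Qed.

Lemma mixedV_coord (p : {poly rat}) i : `|ratr p`_i| <= mu_poly (mixedV a) p.
Proof.
have [ip|pi] := ltnP i (size p).
  by rewrite (nu_mixedV (leqnn _)) (@mixed_norm_coord a (fun i => ratr p`_i)).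
by rewrite nth_default // rmorph0 normr0; apply/mu_poly_ge0/mixedV_seminorm.
Qed.

Lemma mixedV_mubar_coord (P : {poly R}) i : `|P`_i| <= mubar_poly (mixedV a) P.
Proof.
have h : (fun k => `|ratr (approx_poly k P)`_i : R|) @ \oo --> `|P`_i|.
  by apply: cvg_norm; exact: approx_poly_cvg.
have h' := @mubar_poly_approx_cvg _ _ mixedV_seminorm P.
apply: (ler_cvg_to h h').
by near=> k; exact: mixedV_coord.
Unshelve. all: by end_near. Qed.

(** Whatever the weights, the seminorm dominates every coordinate. Hence its extension is definite
    and the monomials stay independent in the completion. *)
Lemma mixedV_Bset : Bset R (mixedV a).
Proof.
have sn := mixedV_seminorm; split; first split=> // n.
  exists (fun i => seq_of (fun=> 'X^i)); split=> [i|c].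
    apply/Xmu_seq_ofP => e e0; exists 0%N => k l _ _.
    by rewrite subrr -(scale0r 0) (mubar_polyZ sn) normr0 mul0r.
  rewrite XcombE; set s := \sum_i _.
  pose P := \sum_i c i *: 'X^i : {poly R}.
  have -> : Xnorm (mixedV a) (seq_of s) = mubar_poly (mixedV a) P.
    rewrite /Xnorm (_ : (fun k => _) = fun=> mubar_poly (mixedV a) P).
      by rewrite lim_cst.
    by apply/funext => k; rewrite /seq_of /mubar_poly /s fct_sumE.
  move=> s0 i; apply/eqP; rewrite -normr_le0 -s0.
  have := mixedV_mubar_coord P i.
  rewrite coef_sum (bigD1 i) //= coefZ coefXn eqxx mulr1 big1 ?addr0 // => j ji.
  by rewrite coefZ coefXn eq_sym (inj_eq val_inj) (negPf ji) mulr0.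
move=> x /finsupp_polyE[P ->] P0; apply/funext => i; apply/eqP.
rewrite -normr_le0; apply: le_trans (mixedV_mubar_coord _ _) _.
by rewrite /mubar_poly P0.
Qed.

Lemma nu_mixedV_Xn m : mu_poly (mixedV a) 'X^m = 1.
Proof.
rewrite (@nu_mixedV _ m.+1) ?size_polyXn //=.
have -> : mixed_norm a (fun i => ratr ('X^m)`_i) m = 0.
  rewrite (@eq_mixed_norm _ _ (fun=> 0)).
    by rewrite (@mixed_norm_stable _ a01 _ 0).
  by move=> i im; rewrite coefXn (ltn_eqF im) rmorph0.
rewrite coefXn eqxx rmorph1 normr1 add0r mulr1.
have /andP[_ am] := a01 m.
by rewrite (max_idPr ler01) (max_idPl am).
Qed.

(** Beyond the degrees of the finitely many combinations there is an [m] with [a m = 1]; adjoining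
    ['X^m] is then an exact sum-norm step. *)
Lemma mixedV_ell1_witness :
  (forall m, exists2 n, (m <= n)%N & a n = 1) ->
  forall n v cs k, ell1_witness (mu_poly (mixedV a)) (n := n) v cs k.
Proof.
move=> a1 n v cs k; pose u (c : {ffun 'I_n -> rat}) := \sum_i c i *: v i.
have [m hm am] := a1 (\max_(c <- cs) size (u c))%N.
exists 'X^m; rewrite nu_mixedV_Xn subrr normr0; split=> [|c cin].
  by rewrite invr_gt0.
rewrite -/(u c); have um : (size (u c) <= m)%N.
  by apply: leq_trans hm; exact: (leq_bigmax_seq _ cin).
have -> : mu_poly (mixedV a) (u c + 'X^m) = mu_poly (mixedV a) (u c) + 1.
  rewrite (@nu_mixedV (u c + 'X^m) m.+1); last first.
    rewrite (leq_trans (size_polyD _ _)) // geq_max size_polyXn leqnn andbT.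
    exact: leqW.
  rewrite (nu_mixedV um) /= coefD coefXn eqxx (nth_default _ um) add0r rmorph1.
  rewrite normr1 am mul1r.
  rewrite (@eq_mixed_norm _ _ (fun i => ratr (u c)`_i)) => [|i im].
    set A := mixed_norm _ _ _; have A0 : 0 <= A by exact: mixed_norm_ge0.
    by apply/max_idPr; rewrite ge_max lerDl lerDr ler01 A0.
  by rewrite coefD coefXn (ltn_eqF im) addr0.
by rewrite ltrBlDr ltrDl invr_gt0.
Qed.

(** Test ['X^m] and its opposite with tolerance [1/4]. A witness [w] of norm [W] would force both
    [|1 + w_m|] and [|-1 + w_m|] above [3/4 + W > 3/2], as the last [m]-dependent steps are maxima;
    but [|w_m| <= W < 5/4] excludes this. *)
Lemma mixedV_no_ell1_witness m : (forall n, (m <= n)%N -> a n = 0) ->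
  ~ forall v cs k, ell1_witness (mu_poly (mixedV a)) (n := 1) v cs k.
Proof.
pose cst1 (t : rat) : {ffun 'I_1 -> rat} := [ffun=> t].
move=> am /(_ [ffun=> 'X^m] [:: cst1 1; cst1 (- 1)] 3%N)[w [w1 hw]].
set W := mu_poly (mixedV a) w in w1 hw.
have upper (t : rat) : mu_poly (mixedV a) (t *: 'X^m + w) <=
    Num.max W `|ratr t + ratr w`_m|.
  pose n := maxn m.+1 (size w).
  rewrite (@nu_mixedV _ n); last first.
    rewrite (leq_trans (size_polyD _ _)) // geq_max leq_maxr andbT.
    rewrite (leq_trans (size_scale_leq _ _)) // size_polyXn leq_maxl //.
  rewrite /W (@nu_mixedV w n) ?leq_maxr //.
  apply: le_trans (@mixed_norm_update a (fun i => ratr w`_i) _ m n _ am _) _.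
  - by rewrite leq_maxl.
  - by move=> i im; rewrite coefD coefZ coefXn (negPf im) mulr0 add0r.
  - by rewrite coefD coefZ coefXn eqxx mulr1 rmorphD.
have lower (t : rat) : `|t| = 1 -> cst1 t \in [:: cst1 1; cst1 (- 1)] ->
    3 / 4 + W < Num.max W `|ratr t + ratr w`_m|.
  move=> t1 tin; have := hw _ tin; rewrite big_ord1 !ffunE.
  rewrite (mu_polyZ mixedV_seminorm) t1 rmorph1.
  rewrite nu_mixedV_Xn => h; apply: lt_le_trans (upper t).
  by apply: le_lt_trans h; lra.
have hw0 : `|ratr w`_m| <= W by exact: mixedV_coord.
have h1 := lower 1 (normr1 _); rewrite mem_head in h1.
have h2 := lower (- 1) (normrN1 _); rewrite in_cons mem_head orbT in h2.
have := h1 isT; have := h2 isT.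
rewrite !lt_max rmorphN1 rmorph1 => /orP[|h3]; first lra.
move=> /orP[|h4]; first lra.
move: hw0 w1 h3 h4; rewrite ler_norml ltr_norml !ltr_normr.
by move=> /andP[? ?] /andP[? ?] /orP[?|?] /orP[?|?]; lra.
Qed.

End MixedSpace.
End MixedNorm.

Lemma continuous_maxr (R : realType) (Z : topologicalType) (f g : Z -> R) :
  continuous f -> continuous g -> continuous (fun z => Num.max (f z) (g z)).
Proof.
by move=> cf cg z; exact: (@continuous_max R Z f g z (cf z) (cg z)).
Qed.

Lemma mixedV_continuous (R : realType) (Z : topologicalType)
    (a : Z -> nat -> R) :
  (forall n, continuous (a^~ n)) ->
  continuous (fun z => mixedV (a z) : RV R).
Proof.
move=> ca; apply: RV_continuous => v; rewrite /mixedV.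
set n := projT1 _; elim: n => [|n IH] /=; first exact: cst_continuous.
set x := `|_|; apply: continuous_maxr.
  by apply: continuous_maxr; [exact: IH|exact: cst_continuous].
move=> z; apply: cvgM; first exact: ca.
by apply: cvgD; [exact: IH|exact: cst_continuous].
Qed.

(** * Hardness *)

Section Weights.
Variables (R : realType) (Z : topologicalType) (d : Z -> Z -> R).
Hypothesis d_ge0 : forall x y, 0 <= d x y.
Hypothesis d0 : forall x, d x x = 0.
Hypothesis dC : forall x y, d x y = d y x.
Hypothesis dT : forall x y z, d x z <= d x y + d y z.
Hypothesis nbhs_d : forall (x : Z) (A : set Z),
  nbhs x A <-> exists2 e : R, 0 < e & [set y | d x y < e] `<=` A.

(* The distance from [z] to the complement of [E], truncated at [c]; unlike
   an infimum over the complement, it needs no convention when [E] is full. *)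
Definition depth (c : R) (E : set Z) (z : Z) : R :=
  sup [set e | 0 <= e <= c /\ forall y, d z y < e -> E y].

Section Depth.
Variables (c : R) (E : set Z).
Hypothesis c0 : 0 <= c.

Lemma depth_ge e z :
  0 <= e <= c -> (forall y, d z y < e -> E y) -> e <= depth c E z.
Proof.
move=> ec zE; apply: ub_le_sup => //=.
by exists c => x [/andP[_ ?] _].
Qed.

Lemma depth_ge0 z : 0 <= depth c E z.
Proof.
apply: depth_ge; first by rewrite lexx.
by move=> y; rewrite ltNge d_ge0.
Qed.

Lemma depth_le_ub b z : 0 <= b ->
  (forall e, 0 <= e <= c -> (forall y, d z y < e -> E y) -> e <= b) ->
  depth c E z <= b.
Proof.
move=> b0 h; apply: ge_sup => [|e [ec zE]]; last exact: h.
exists 0; split; first by rewrite lexx.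
by move=> y; rewrite ltNge d_ge0.
Qed.

Lemma depth_le z : depth c E z <= c.
Proof. by apply: depth_le_ub => // e /andP[]. Qed.

Lemma depth_gt0 z : 0 < depth c E z -> E z.
Proof.
apply: contraPP => nE; apply/negP; rewrite -leNgt; apply: depth_le_ub => //.
move=> e _ zE; rewrite leNgt; apply/negP => e0; apply: nE; apply: zE.
by rewrite d0.
Qed.

Lemma open_depth_gt0 z : 0 < c -> open E -> E z -> 0 < depth c E z.
Proof.
move=> cp oE Ez; have /nbhs_d[e e0 he] : nbhs z E by exact: open_nbhs_nbhs.
apply: (@lt_le_trans _ _ (Num.min e c)); first by rewrite lt_min e0.
apply: depth_ge; first by rewrite le_min (ltW e0) c0 ge_min lexx orbT.
by move=> y; rewrite lt_min => /andP[? _]; exact: he.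
Qed.

(** If the ball of radius [e] about [z] lies in [E], so does the ball of radius [e - d z t] about
    [t]. *)
Lemma depth_lipschitz z t : depth c E z <= depth c E t + d z t.
Proof.
apply: depth_le_ub => [|e /andP[e0 ec] zE].
  by rewrite addr_ge0 ?depth_ge0.
have [ed|de] := leP e (d z t).
  by apply: le_trans ed _; rewrite lerDr depth_ge0.
rewrite -lerBlDr; apply: depth_ge => [|y].
  rewrite subr_ge0 (ltW de) /=; apply: le_trans ec; rewrite gerBl //.
by rewrite ltrBrDl => ty; apply: zE; exact: le_lt_trans (dT _ t _) ty.
Qed.

Lemma depth_continuous : continuous (depth c E).
Proof.
move=> z; apply/(@cvgrPdist_lt _ _ _ (nbhs z) _ (depth c E)) => e e0.
apply/nbhs_d; exists e => // t /= zt; rewrite ltr_norml.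
have := depth_lipschitz z t; have := depth_lipschitz t z; rewrite (dC t z).
by move=> ? ?; apply/andP; split; lra.
Qed.

End Depth.

Variable F : nat -> set Z.
Hypothesis oF : forall i, open (F i).

(** Intersecting makes the levels decrease: a point outside [F j] has depth 0 at every level
    [i >= j], so only finitely many levels can contribute there. *)
Let E i : set Z := [set y | forall j, j \in iota 0 i.+1 -> F j y].

Let oE i : open (E i).
Proof. exact: open_all_seq. Qed.

Let g i := depth i.+1%:R^-1 (E i).

(** A continuous bump vanishing at 0 and from 3 on, and at least 1 on [[1, 2]]. *)
Let tent (t : R) := Num.max 0 (3 - `|2 * t - 3|).

(* Weight [n] sees level [i] when [1 <= n * g i <= 2], which happens for some
   [n > i] as soon as [g i > 0], but never for large [n]. *)
Definition weight (z : Z) (n : nat) : R :=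
  Num.min 1 (\sum_(i < n) tent (n%:R * g i z)).

Let tent_ge0 t : 0 <= tent t.
Proof. by rewrite le_max lexx. Qed.

Let tent_ge1 t : 1 <= t <= 2 -> 1 <= tent t.
Proof.
move=> /andP[t1 t2]; rewrite le_max; apply/orP; right.
by rewrite lerBrDl -lerBrDr ler_norml; apply/andP; split; lra.
Qed.

Let tent_eq0 t : t = 0 \/ 3 <= t -> tent t = 0.
Proof.
move=> h; apply/max_idPl; rewrite subr_le0.
case: h => [->|t3]; first by rewrite mulr0 sub0r normrN ger0_norm.
by rewrite ger0_norm; lra.
Qed.

Let ic_ge0 i : 0 <= i.+1%:R^-1 :> R.
Proof. by rewrite invr_ge0. Qed.

Lemma weight01 z n : 0 <= weight z n <= 1.
Proof. by rewrite le_min ler01 sumr_ge0 //= ge_min lexx. Qed.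

Lemma weight_continuous n : continuous (weight^~ n).
Proof.
have cg i : continuous (fun z => n%:R * g i z).
  by move=> z; apply: cvgM; [exact: cst_continuous|exact: depth_continuous].
have ct i : continuous (fun z => tent (n%:R * g i z)).
  apply: continuous_maxr; first exact: cst_continuous.
  move=> z; apply: cvgB; first exact: cst_continuous.
  apply: cvg_norm; apply: cvgB; last exact: cst_continuous.
  by apply: cvgM; [exact: cst_continuous|exact: cg].
have cs : continuous (fun z => \sum_(i < n) tent (n%:R * g i z)).
  move=> z; apply: cvg_big => [|i _]; last exact: ct.
  exact: add_continuous.
move=> z.
exact: (@continuous_min R Z (fun=> 1) _ z (@cst_continuous _ _ _ _) (cs z)).
Qed.

Lemma weight_in z : (forall i, F i z) ->
  forall m, exists2 n, (m <= n)%N & weight z n = 1.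
Proof.
move=> Fz m; have gm : 0 < g m z.
  by apply: open_depth_gt0 => //; rewrite invr_gt0.
have g1 : g m z <= m.+1%:R^-1 by exact: depth_le.
have ex : exists n, 1 <= n%:R * g m z.
  exists (Num.truncn (g m z)^-1).+1; rewrite -ler_pdivrMr // div1r.
  exact/ltW/truncnS_gt.
(* Take the least [n] with [n * g m z >= 1]. The truncation [g m z <= 1/(m+1)] forces [n > m], so
   level [m] occurs in the sum for weight [n]; minimality and [g m z <= 1] give [n * g m z <= 2]. *)
case: (ex_minnP ex) => n n1 nmin.
have mn : (m < n)%N.
  rewrite -(ltr_nat R) ltNge; apply/negP => nm.
  have : n%:R * g m z <= m%:R * m.+1%:R^-1.
    by apply: ler_pM => //; exact: ltW.
  move=> /(le_trans n1); rewrite ler_pdivlMr // mul1r ler_nat ltnn.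
  by [].
have n2 : n%:R * g m z <= 2.
  case: n n1 nmin mn => // n n1 nmin mn.
  have ng : n%:R * g m z < 1.
    by rewrite ltNge; apply/negP => /nmin; rewrite ltnn.
  have gle1 : g m z <= 1 by apply: le_trans g1 _; rewrite invf_le1 // ler1n.
  by rewrite -[n.+1%:R]natr1 mulrDl mul1r; apply: lerD gle1; exact: ltW.
exists n; first exact: ltnW.
apply/min_idPl; rewrite (bigD1 (Ordinal mn)) //=.
by apply: ler_wpDr; [exact: sumr_ge0|exact/tent_ge1/andP].
Qed.

Lemma weight_notin z j : ~ F j z ->
  exists m, forall n, (m <= n)%N -> weight z n = 0.
Proof.
(* Levels from [j] on have depth 0. Each lower level of positive depth is pushed past 3 by large
   [n]; at depth 0 the quotient is 0 by convention and the bump vanishes anyway. *)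
move=> nF; exists (\max_(i < j) (Num.truncn (3 / g i z)).+1)%N => n mn.
rewrite /weight big1 ?(min_idPr ler01) // => i _; apply: tent_eq0.
have [gi|gi] := eqVneq (g i z) 0; first by left; rewrite gi mulr0.
have gp : 0 < g i z by rewrite lt_neqAle eq_sym gi depth_ge0.
right; have ij : (i < j)%N.
  rewrite ltnNge; apply/negP => ji; apply: nF; apply: (depth_gt0 (ic_ge0 i) gp).
  by rewrite mem_iota /= add0n ltnS.
rewrite -ler_pdivrMr //; apply: le_trans (ltW (truncnS_gt _)) _.
rewrite ler_nat; apply: leq_trans mn.
exact: (leq_bigmax (Ordinal ij)).
Qed.

End Weights.

(** One map serves both classes: weights equal to 1 infinitely often give witnesses for families of
    every size, while eventually vanishing weights already defeat one-element families, refuting LOH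
    and OH together. *)
Lemma Gdelta_hard (R : realType) (Z : topologicalType) (B : set Z) :
  polish R Z -> Gdelta B ->
  exists f : Z -> RV R, continuous f /\ (forall z, Bset R (f z)) /\
    forall z, (B z -> LOH (f z) /\ OH (f z)) /\
              (~ B z -> ~ LOH (f z) /\ ~ OH (f z)).
Proof.
move=> [[d [dge [deq [dC [dT [nd _]]]]]] _] [F oF ->].
have d0 x : d x x = 0 by exact/deq.
have w01 := weight01 d F.
exists (fun z => mixedV (weight d F z)); split.
  by apply: mixedV_continuous => n; exact: weight_continuous.
split=> [z|z]; first exact/mixedV_Bset/w01.
have sn := mixedV_seminorm (w01 z).
rewrite (LOHP sn) (OHP sn); split=> [Fz|nF].
  have wit := mixedV_ell1_witness (w01 z)
    (weight_in dge nd oF (fun i => Fz i I)).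
  by split => [|n]; exact: wit.
have [j nFj] : exists j, ~ F j z.
  by apply/existsNP => h; apply: nF => j _.
have [m hm] := weight_notin dge d0 nFj.
have nw := mixedV_no_ell1_witness (w01 z) hm.
by split => // h; exact: nw (h 1).
Qed.

(** * Completeness of both classes in the three spaces *)

Theorem theorem6p2 (R : realType) (I : set (RV R)) :
  I = Pset R \/ I = Pinf R \/ I = Bset R ->
  Gdelta_complete I (I `&` [set mu | LOH mu]) /\
  Gdelta_complete I (I `&` [set mu | OH mu]).
Proof.
move=> hI.
have IP : I `<=` Pset R by case: hI => [->|[->|->]] // mu; [case|case; case].
have BI : Bset R `<=` I by case: hI => [->|[->|->]] // mu; [case; case|case].
(* The upper bound is inherited from the largest space [Pset R], and the reduction lands in the
   smallest one, [Bset R]; so one argument covers the three choices of [I]. *)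
have complete (L : (V -> R) -> Prop) :
    (exists G : nat -> set (RV R), (forall i, open (G i)) /\
      forall mu, Pset R mu -> L mu <-> (\bigcap_i G i) mu) ->
    (forall (Z : topologicalType) (B : set Z), polish R Z -> Gdelta B ->
      exists f : Z -> RV R, continuous f /\ (forall z, Bset R (f z)) /\
        forall z, (B z -> L (f z)) /\ (~ B z -> ~ L (f z))) ->
    Gdelta_complete I (I `&` [set mu | L mu]).
  move=> [G [oG GL]] hard; split; first exact: subIsetl.
  split=> [|Z pZ _ B GB].
    exists G; split=> //; apply/seteqP.
    by split=> mu [Imu h]; split=> //; apply/(GL mu (IP _ Imu)).
  have [f [cf [fB fL]]] := hard Z B pZ GB.
  exists f; split=> //; split=> [z|]; first exact/BI/fB.
  apply/seteqP; split=> z /=; have [h1 h2] := fL z.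
    by move=> Bz; split; [exact/BI/fB|exact: h1].
  by move=> [_ Lz]; apply: contrapT => /h2.
split; apply: complete; [exact: Gdelta_LOH| |exact: Gdelta_OH|].
- move=> Z B pZ GB; have [f [cf [fB fL]]] := Gdelta_hard pZ GB.
  exists f; do 2 split => //.
  by move=> z; have [h1 h2] := fL z; split=> [/h1[]|/h2[]].
- move=> Z B pZ GB; have [f [cf [fB fL]]] := Gdelta_hard pZ GB.
  exists f; do 2 split => //.
  by move=> z; have [h1 h2] := fL z; split=> [/h1[]|/h2[]].
Qed.
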